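(* For every $q\in\mathbb R$, the limit $$\Lambda(q):=\lim_{n\to\infty} n^{-1}\log\mathbb E[N_n^q]$$ exists. For $q\ge 0$ one has $\Lambda(q)=\inf_{n\ge1} n^{-1}\log\mathbb E[N_n^q]$, while for $q<0$ one has $\Lambda(q)=\sup_{n\ge1} n^{-1}\log\mathbb E[N_n^q]$. Moreover, $\Lambda$ is finite and convex on $\mathbb R$, and $$\min\{0,q\log 2\}\le \Lambda(q)\le \max\{0,q\log 2\}\qquad\text{for all } q\in\mathbb R.$$ If $I_+(x):=\sup_{q\ge0}\{qx-\Lambda(q)\}$ and $I_-(x):=\sup_{q\le0}\{qx-\Lambda(q)\}$, then, for every $x\in\mathbb R$, $$\limsup_{n\to\infty} n^{-1}\log\mathbb P(X_n\ge x)\le -I_+(x) \qquad\text{and}\qquad \limsup_{n\to\infty} n^{-1}\log\mathbb P(X_n\le x)\le -I_-(x).$$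
   Context: Fix $0<\varepsilon<1$. For $a,b>0$ let $h(a,b):=ab/(a+b)$, and let $$U_\varepsilon:=\{(a,b)\in(0,\infty)^2: |a-2|\le\varepsilon,\ |b-2|\le\varepsilon,\ h(a,b)\le1\}.$$ Let $\mu_\varepsilon$ be a probability measure supported on $U_\varepsilon$ and let $(\omega_n)_{n\ge1}$ be i.i.d. with law $\mu_\varepsilon$. For $\omega=(a,b)\in U_\varepsilon$ define the tent map $T_\omega(x):=\max\{0,\min(ax,b(1-x))\}$; it maps $[0,1]$ into $[0,1]$. Set $F_n:=T_{\omega_n}\circ\cdots\circ T_{\omega_1}$. For an interval $J$ and a map $f$, $A(f;J)$ denotes the smallest number of subintervals partitioning $J$ on each of which $f$ is affine. Set $N_n:=A(F_n;[0,1])$ and $X_n:=n^{-1}\log N_n$. Conventions: $\log 0=-\infty$; $I_\pm$ may take the value $+\infty$. *)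

(* Defs.v *)
From HB Require Import structures.
From mathcomp Require Import all_boot all_order all_algebra.
From mathcomp Require Import all_classical all_reals all_analysis.

Set Implicit Arguments.
Unset Strict Implicit.
Unset Printing Implicit Defensive.

Import Order.TTheory GRing.Theory Num.Theory.
Import numFieldNormedType.Exports.

Local Open Scope classical_set_scope.
Local Open Scope ring_scope.

Section tent_maps.
Context {R : realType}.

Definition crossing_height (a b : R) : R := a * b / (a + b).

Definition param_set (eps : R) : set (R * R) :=
  [set w | [/\ 0 < w.1, 0 < w.2, `|w.1 - 2| <= eps, `|w.2 - 2| <= eps
             & crossing_height w.1 w.2 <= 1]].

Definition tent (w : R * R) (x : R) : R :=
  Num.max 0 (Num.min (w.1 * x) (w.2 * (1 - x))).

(* The parameter sequence is indexed from 0: w k is the parameter of the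
   (k+1)-st map applied, so tent_comp w n = T_{w (n-1)} o ... o T_{w 0}. *)
Fixpoint tent_comp (w : nat -> R * R) (n : nat) (x : R) : R :=
  if n is m.+1 then tent (w m) (tent_comp w m x) else x.

Definition affine_on (f : R -> R) (I : set R) : Prop :=
  exists m c : R, forall x, I x -> f x = m * x + c.

Definition affine_partition (f : R -> R) (J : set R) (k : nat) : Prop :=
  exists I : 'I_k -> set R,
    [/\ classical_sets.partition [set: 'I_k] I J,
        forall i, is_interval (I i) & forall i, affine_on f (I i)].

(* The smallest k such that J splits into k affine pieces of f; it would be 0
   if f were not piecewise affine on J with finitely many pieces, which does
   not occur for compositions of tent maps. *)
Definition affine_pieces (f : R -> R) (J : set R) : nat :=
  [get k | affine_partition f J k /\
           forall j, affine_partition f J j -> (k <= j)%N].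

End tent_maps.

Section probability.
Context {R : realType} {d : measure_display} {Omega : measurableType d}.
Variable P : probability Omega R.

Definition mutually_independent {d' : measure_display} {T : measurableType d'}
    (X : nat -> Omega -> T) : Prop :=
  forall (s : seq nat) (B : nat -> set T), uniq s ->
    (forall i, measurable (B i)) ->
    P (\bigcap_(i in [set` s]) (X i @^-1` B i)) =
    (\prod_(i <- s) P (X i @^-1` B i))%E.

Definition iid_with_law {d' : measure_display} {T : measurableType d'}
    (X : nat -> {mfun Omega >-> T}) (mu : probability T R) : Prop :=
  (forall n (B : set T), measurable B -> distribution P (X n) B = mu B) /\
  mutually_independent (fun n => X n : Omega -> T).

Variable omega : nat -> {mfun Omega >-> (R * R)%type}.

Definition piece_count (n : nat) (t : Omega) : nat :=
  affine_pieces (tent_comp (fun k => omega k t) n) `[0, 1].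

Definition growth_rate (n : nat) (t : Omega) : R :=
  n%:R^-1 * ln (piece_count n t)%:R.

Definition scaled_log_moment (q : R) (n : nat) : \bar R :=
  ((n%:R^-1)%:E * lne 'E_P[fun t => ((piece_count n t)%:R `^ q)%R])%E.

Definition Lambda (q : R) : \bar R := limn (scaled_log_moment q).

Definition I_plus (x : R) : \bar R :=
  ereal_sup [set ((q * x)%:E - Lambda q)%E | q in [set q : R | 0 <= q]].

Definition I_minus (x : R) : \bar R :=
  ereal_sup [set ((q * x)%:E - Lambda q)%E | q in [set q : R | q <= 0]].

(* lne 0 = -oo, so a null event contributes -oo for n > 0. *)
Definition scaled_log_prob (A : nat -> set Omega) (n : nat) : \bar R :=
  ((n%:R^-1)%:E * lne (P (A n)))%E.

End probability.

(* Main.v *)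
(* The pieces of [g \o f] are cut out by the pieces of [f] and the preimages under
   [f] of the pieces of [g], so the number of pieces is submultiplicative along
   an orbit: N_(n+m) <= N_n * N'_m with N'_m an independent copy of N_m.  Hence
   log E[N_n^q] is subadditive in n for q >= 0 and superadditive for q < 0, and
   Fekete's lemma gives the limit; 1 <= N_n <= 2^n gives the bounds, Hoelder's
   inequality the convexity, and Chernoff's inequality the two tail estimates.

   N_n must be measurable on the whole of Omega, since P is unconstrained on
   nonmeasurable sets.  For continuous f, having more than k pieces is equivalent
   to the existence of rational points 0 = s_0 < s_1 < ... < s_k <= 1 such that f
   is affine on no [s_(i-1), s_i], which is a countable condition on the values
   of f at rational points. *)
Require Import Defs.
From HB Require Import structures.
From mathcomp Require Import all_boot all_order all_algebra.
From mathcomp Require Import all_classical all_reals all_analysis.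
From mathcomp Require Import measurable_realfun ring lra.

Set Implicit Arguments.
Unset Strict Implicit.
Unset Printing Implicit Defensive.

Import Order.TTheory GRing.Theory Num.Theory.
Import numFieldNormedType.Exports.

Local Open Scope classical_set_scope.
Local Open Scope ring_scope.

(** * Counting affine pieces *)

Section affine_pieces.
Context {R : realType}.
Implicit Types (f g : R -> R) (p s x y z : R) (I J : set R).

(** * Affinity on closed intervals, tested on rational points *)

Lemma continuous_eq0_itv g p s : continuous g -> p < s ->
  (forall r : rat, p < ratr r < s -> g (ratr r) = 0) ->
  forall x, p <= x <= s -> g x = 0.
Proof.
move=> cg ps g0 x /andP[px xs]; apply/eqP/negP => /negP gx0.
have := cg x; move/cvgrPdist_lt => /(_ `|g x|).
rewrite normr_gt0 => /(_ gx0) /nbhs_ballP[e /= e0 xe].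
(* Clipping the neighbourhood by [p] and [s] puts the rational strictly inside the interval even
   when [x] is an endpoint. *)
have [r] : exists r : rat, ratr r \in `]Num.max p (x - e), Num.min s (x + e)[.
  apply: rat_in_itvoo; rewrite lt_min !gt_max ps/=.
  by apply/andP; split; [|apply/andP; split]; lra.
rewrite in_itv/= gt_max lt_min => /andP[/andP[pr xer] /andP[rs rxe]].
have /xe/= : ball x e (ratr r) by rewrite /ball/= ltr_distlC; lra.
by rewrite g0 ?pr ?rs// subr0 ltxx.
Qed.

Lemma affine_on_subset f I J : I `<=` J -> affine_on f J -> affine_on f I.
Proof. by move=> IJ [m [c fJ]]; exists m, c => x /IJ /fJ. Qed.

(** The chord equation, multiplied out by [s - p]. Free of division, its left side is continuous in
    [y], in [p] and in [s] when [f] is, and measurable in any parameter on which the values of [f]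
    depend measurably. *)
Lemma affine_on_itvP f p s : p < s ->
  affine_on f `[p, s] <->
  (forall y, p <= y <= s -> (s - p) * f y - (s - y) * f p - (y - p) * f s = 0).
Proof.
move=> ps; split.
  move=> [m [c fmc]] y /andP[py ys].
  by rewrite !fmc /= ?in_itv/= ?lexx ?py ?ys ?(ltW ps)//; ring.
move=> h; exists ((f s - f p) / (s - p)), (f p - (f s - f p) / (s - p) * p).
move=> y; rewrite /= in_itv/= => /h hy.
have sp0 : s - p != 0 by rewrite subr_eq0 gt_eqF.
apply: (mulfI sp0).
have -> : (s - p) * f y = (s - y) * f p + (y - p) * f s by lra.
by field.
Qed.

Lemma affine_on_itv_ratP f p s : continuous f -> p < s ->
  affine_on f `[p, s] <->
  (forall r : rat, p < ratr r < s ->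
    (s - p) * f (ratr r) - (s - ratr r) * f p - (ratr r - p) * f s = 0).
Proof.
move=> cf ps; split.
  by move/(affine_on_itvP _ ps) => h r /andP[pr rs]; rewrite h// !ltW.
move=> h; apply/(affine_on_itvP _ ps).
apply: (@continuous_eq0_itv
  (fun y => (s - p) * f y - (s - y) * f p - (y - p) * f s) p s) => // y.
apply: cvgB; [apply: cvgB|].
- by apply: cvgM; [exact: cvg_cst|exact: cf].
- by apply: cvgM; [apply: cvgB; [exact: cvg_cst|exact: cvg_id]|exact: cvg_cst].
- by apply: cvgM; [apply: cvgB; [exact: cvg_id|exact: cvg_cst]|exact: cvg_cst].
Qed.

(** For fixed [y], the chord defect at [y] on [[p, x]] is continuous in the endpoint [x]. It
    vanishes at the rational [x] between [y] and [s], hence also at [x = s]. *)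
Lemma affine_on_itv_left f p s : continuous f -> p < s ->
  (forall r : rat, p < ratr r < s -> affine_on f `[p, ratr r]) ->
  affine_on f `[p, s].
Proof.
move=> cf ps h; apply/(affine_on_itvP _ ps) => y /andP[py ys].
have [->|ys'] := eqVneq y s; first by ring.
apply: (@continuous_eq0_itv
  (fun x => (x - p) * f y - (x - y) * f p - (y - p) * f x) y s) => //.
- move=> x; apply: cvgB; [apply: cvgB|].
  + by apply: cvgM; [apply: cvgB; [exact: cvg_id|exact: cvg_cst]|exact: cvg_cst].
  + by apply: cvgM; [apply: cvgB; [exact: cvg_id|exact: cvg_cst]|exact: cvg_cst].
  + by apply: cvgM; [exact: cvg_cst|exact: cf].
- by rewrite lt_neqAle ys'.
- move=> r /andP[yr rs]; have pr := le_lt_trans py yr.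
  have := h r; rewrite pr rs => /(_ isT)/(affine_on_itvP _ pr); apply.
  by rewrite py ltW.
- by rewrite ys lexx.
Qed.

Lemma affine_on_itv_right f p s : continuous f -> p < s ->
  (forall r : rat, p < ratr r < s -> affine_on f `[ratr r, s]) ->
  affine_on f `[p, s].
Proof.
move=> cf ps h; apply/(affine_on_itvP _ ps) => y /andP[py ys].
have [->|yp] := eqVneq y p; first by ring.
apply: (@continuous_eq0_itv
  (fun x => (s - x) * f y - (s - y) * f x - (y - x) * f s) p y) => //.
- move=> x; apply: cvgB; [apply: cvgB|].
  + by apply: cvgM; [apply: cvgB; [exact: cvg_cst|exact: cvg_id]|exact: cvg_cst].
  + by apply: cvgM; [exact: cvg_cst|exact: cf].
  + by apply: cvgM; [apply: cvgB; [exact: cvg_cst|exact: cvg_id]|exact: cvg_cst].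
- by rewrite lt_neqAle eq_sym yp.
- move=> r /andP[pr ry]; have rs := lt_le_trans ry ys.
  have := h r; rewrite pr rs => /(_ isT)/(affine_on_itvP _ rs); apply.
  by rewrite ys ltW.
- by rewrite py lexx.
Qed.

(** * Kinks, affine covers and the minimal number of pieces *)

(** The rational points [s_1 < ... < s_k] of the countable criterion, picked one after the other
    from [p] on. The recursion lets measurability be proved by induction on [k], with one countable
    union per step. *)
Fixpoint kinks f (k : nat) p : Prop :=
  if k is j.+1 then
    exists s : rat, [/\ p < (ratr s : R) <= 1, ~ affine_on f `[p, ratr s]
                      & kinks f j (ratr s)]
  else True.

(** A relaxation of partitions that is stable under composition: the sets may overlap, be empty or
    leave [J], and any finite type, such as a product, may index them. *)
Definition affine_cover f J (k : nat) : Prop :=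
  exists (T : finType) (F : T -> set R),
    [/\ (#|T| <= k)%N, forall i, is_interval (F i),
        forall i, affine_on f (F i `&` J) & forall x, J x -> exists i, F i x].

(** A pigeonhole argument: the set of the cover that contains [p] cannot reach the first kink [s],
    for it would then contain [[p, s]], where [f] is not affine. It is discarded, and the induction
    continues from [s] with one set and one kink fewer. *)
Lemma kinks_lt_card f (T : finType) (F : T -> set R) (S : {set T}) k p :
  (forall i, is_interval (F i)) ->
  (forall i, affine_on f (F i `&` `[p, 1])) -> p <= 1 ->
  (forall x, p <= x <= 1 -> exists2 i, i \in S & F i x) ->
  kinks f k p -> (k < #|S|)%N.
Proof.
move=> iF; elim: k p S => [|k ih] p S aF p1 cF.
  move=> _; have [|i iS _] := cF p; first by rewrite lexx.
  by apply/card_gt0P; exists i.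
move=> [s [/andP[ps s1] naf ks]].
have [|i iS Fip] := cF p; first by rewrite lexx.
have Fi y : ratr s <= y -> ~ F i y.
  move=> sy Fiy; apply: naf; apply: affine_on_subset (aF i) => z/=.
  rewrite !in_itv/= => /andP[pz zs]; split; last by rewrite pz (le_trans zs).
  by apply: iF Fip Fiy _ _; rewrite pz (le_trans zs).
rewrite (cardsD1 i) iS/= ltnS; apply: (ih (ratr s)) => //.
- move=> j; apply: affine_on_subset (aF j) => z/= [Fjz].
  by rewrite !in_itv/= => /andP[sz z1]; rewrite z1 (le_trans (ltW ps)).
- move=> x /andP[sx x1]; have [|j jS Fjx] := cF x.
    by rewrite x1 (le_trans (ltW ps)).
  exists j => //; rewrite in_setD1 jS andbT.
  by apply/eqP => ji; apply: (Fi x) => //; rewrite -ji.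
Qed.

Lemma affine_partition_cover f J j k : (j <= k)%N ->
  affine_partition f J j -> affine_cover f J k.
Proof.
move=> jk [I [[cI _ _] iI aI]]; exists 'I_j, I; split=> //.
- by rewrite card_ord.
- by move=> i; apply: affine_on_subset (aI i) => x [].
- by move=> x; rewrite -cI => -[i _ Iix]; exists i.
Qed.

Lemma affine_cover_kinks f j k : affine_cover f `[0, 1] j -> kinks f k 0 ->
  (k < j)%N.
Proof.
move=> [T [F [Tj iF aF cF]]] kk; apply: leq_trans Tj.
rewrite -cardsT; apply: (@kinks_lt_card f T F [set: T] k 0) => //.
move=> x x01; have [|i Fix] := cF x; first by rewrite /= in_itv.
by exists i.
Qed.

Lemma affine_partition1 f J : J !=set0 -> is_interval J -> affine_on f J ->
  affine_partition f J 1.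
Proof.
move=> J0 iJ aJ; exists (fun=> J); split=> //; split=> //.
- by apply/seteqP; split=> [x [i _]//|x Jx]; exists ord0.
- by move=> i j _ _ _; rewrite !ord1.
Qed.

Lemma affine_partition_cons f p s j : p < s <= 1 -> affine_on f `[p, s[ ->
  affine_partition f `[s, 1] j -> affine_partition f `[p, 1] j.+1.
Proof.
move=> /andP[ps s1] aps [I [[cI tI nI] iI aI]].
(* Index [ord0] carries the new half-open piece; the old pieces are shifted by one. *)
exists (fun i => oapp I `[p, s[%classic (unlift ord0 i)).
have Is i x : I i x -> s <= x <= 1.
  by move=> Iix; have : cover [set: 'I_j] I x by [exists i|]; rewrite cI/= in_itv.
split; [split| |].
- apply/seteqP; split=> x.
    move=> [i _]; case: unliftP => [i' _ /= /Is|_]; rewrite /= !in_itv/=.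
      by move=> /andP[sx ->]; rewrite (le_trans (ltW ps)).
    by move=> /andP[-> xs]; rewrite (le_trans (ltW xs)).
  rewrite /= in_itv/= => /andP[px x1]; have [xs|sx] := ltP x s.
    by exists ord0 => //; rewrite unlift_none/= in_itv/= px.
  have : `[s, 1]%classic x by rewrite /= in_itv/= sx.
  by rewrite -cI => -[i _ Iix]; exists (lift ord0 i) => //; rewrite liftK.
- move=> i1 i2 _ _; case: unliftP => [i1' ->|->]; case: unliftP => [i2' ->|->] //=.
  + by move=> /(tI _ _ Logic.I Logic.I) ->.
  + by move=> [x [/Is /andP[sx _]]]; rewrite /= in_itv/= ltNge sx andbF.
  + by move=> [x []]; rewrite /= in_itv/= => /andP[_ + /Is/andP[]]; rewrite ltNge => /negP.
- move=> i _; case: unliftP => [i' _|_] /=; first exact: nI.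
  by exists p; rewrite /= in_itv/= lexx.
- by move=> i; case: unliftP => [i' _|_] /=; [exact: iI|exact: interval_is_interval].
- by move=> i; case: unliftP => [i' _|_] /=; [exact: aI|].
Qed.

(* Greedy choice of the pieces: the first one extends from [p] to the supremum
   [c] of the points up to which [f] is affine. *)
Lemma not_kinks_partition f k p : continuous f -> p <= 1 -> ~ kinks f k p ->
  exists2 j, (j <= k)%N & affine_partition f `[p, 1] j.
Proof.
move=> cf; elim: k p => [p _ /(_ Logic.I)//|k ih p p1 nk].
pose A := [set x | p <= x <= 1 /\ affine_on f `[p, x]].
have Ap : A p.
  split; first by rewrite lexx.
  exists 0, (f p) => x; rewrite /= in_itv/= => /andP[px xp].
  by rewrite mul0r add0r (@le_anti _ _ x p)// px xp.
have ubA : has_ubound A by exists 1 => x [/andP[]].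
pose c := sup A.
have pc : p <= c by exact: ub_le_sup.
have c1 : c <= 1 by apply: ge_sup; [exists p|move=> x [/andP[]]].
(* The supremum is attained: affinity up to every rational below [c] passes to [c] by continuity. *)
have apc : affine_on f `[p, c].
  move: pc; rewrite le_eqVlt => /predU1P[<-|pc]; first by case: Ap.
  apply: affine_on_itv_left => // r /andP[pr rc].
  have rc0 : 0 < c - ratr r by rewrite subr_gt0.
  have [x [_ ax]] := sup_adherent rc0 (conj (ex_intro _ p Ap) ubA).
  rewrite subKr => rx.
  apply: affine_on_subset ax => y /=; rewrite !in_itv/= => /andP[-> yr]/=.
  by rewrite (le_trans yr)// ltW.
have [c1'|] := eqVneq c 1.
  exists 1%N => //; apply: affine_partition1; last by rewrite -c1'.
    by exists p; rewrite /= in_itv/= lexx.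
  exact: interval_is_interval.
move=> c1'; have {c1'}c1 : c < 1 by rewrite lt_neqAle c1'.
have nA s : c < s -> s <= 1 -> ~ affine_on f `[p, s].
  move=> cs s1 ps; have : s <= c; last by rewrite leNgt cs.
  by apply: ub_le_sup => //; split=> //; rewrite s1 (le_trans pc (ltW cs)).
(* From [k] kinks after [c] one obtains [k.+1] kinks after [p]. For [k = 0] the point 1 is the extra
   kink, because [c < 1]. *)
have nkc : ~ kinks f k c.
  move=> kc; apply: nk; case: k kc {ih} => [_|k].
    exists 1%Q; rewrite rmorph1; split=> //; last exact: nA.
    by rewrite lexx (le_lt_trans pc).
  move=> [s [/andP[cs s1] ncs ks]].
  (* Since [c] may be irrational, it is replaced by a rational [r] slightly to its right with [f]
     still not affine on [[r, s]]. As [r > c], [f] is not affine on [[p, r]] either, so [r] can be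
     put in front of [s]. *)
  have [r /andP[cr rs] nrs] :
      exists2 r : rat, c < (ratr r : R) < ratr s & ~ affine_on f `[ratr r, ratr s].
    apply: contrapT => /forall2NP h; apply: ncs; apply: affine_on_itv_right => //.
    by move=> r crs; have [//|/contrapT] := h r.
  exists r; split; first by rewrite (le_lt_trans pc cr) (le_trans (ltW rs)).
    by apply: nA => //; rewrite (le_trans (ltW rs)).
  by exists s; rewrite rs.
have [j jk pj] := ih c (ltW c1) nkc.
(* If [c = p], the first piece would be empty and the partition starting at [c] already serves. *)
move: pc; rewrite le_eqVlt => /predU1P[pc|pc]; first by exists j; [exact: leqW|rewrite pc].
exists j.+1 => //; apply: affine_partition_cons pj; first by rewrite pc ltW.
by apply: affine_on_subset apc => x /=; rewrite !in_itv/= => /andP[-> /ltW].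
Qed.

Lemma affine_pieces_min f J j : affine_partition f J j ->
  affine_partition f J (affine_pieces f J) /\ (affine_pieces f J <= j)%N.
Proof.
move=> pj; have ex : exists j, `[< affine_partition f J j >] by exists j; exact/asboolP.
have [m /asboolP pm min] := ex_minnP ex.
have [] := @getPex _ [set k | affine_partition f J k /\
           forall i, affine_partition f J i -> (k <= i)%N].
  by exists m; split=> // i pi; apply: min; exact/asboolP.
by move=> p h; split; [exact: p|exact: h].
Qed.

(** A cover by [k] sets excludes [k] kinks, so the greedy construction gives a genuine partition
    into at most [k] pieces. All upper bounds on the number of pieces may thus be proved with
    covers. *)
Lemma affine_cover_pieces f k : continuous f -> affine_cover f `[0, 1] k ->
  affine_cover f `[0, 1] (affine_pieces f `[0, 1]) /\
  (affine_pieces f `[0%R, 1%R] <= k)%N.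
Proof.
move=> cf ck; have nk : ~ kinks f k 0.
  by move=> /(affine_cover_kinks ck); rewrite ltnn.
have [j jk pj] := not_kinks_partition cf ler01 nk.
have [pm mj] := affine_pieces_min pj.
by split; [exact: affine_partition_cover pm|exact: leq_trans jk].
Qed.

(** The second conjunct expresses that some finite affine partition exists. Without one, [f] has [k]
    kinks for every [k], while [affine_pieces] takes its default value 0. *)
Lemma ltn_affine_pieces f k : continuous f ->
  (k < affine_pieces f `[0%R, 1%R])%N <-> kinks f k 0 /\ exists j, ~ kinks f j 0.
Proof.
move=> cf; split=> [km|[kk [j nj]]].
  have [j pj] : exists j, affine_partition f `[0, 1] j.
    apply: contrapT => /forallNP nP; move: km; rewrite /affine_pieces getPN //.
    by move=> m [/nP].
  split; last first.
    exists j => /(affine_cover_kinks (affine_partition_cover (leqnn j) pj)).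
    by rewrite ltnn.
  apply: contrapT => /(not_kinks_partition cf ler01)[i ik pi].
  have [_ mi] := affine_pieces_min pi.
  by move: km; rewrite ltnNge (leq_trans mi).
have [i _ pi] := not_kinks_partition cf ler01 nj.
have [pm _] := affine_pieces_min pi.
exact: affine_cover_kinks (affine_partition_cover (leqnn _) pm) kk.
Qed.

Lemma affine_pieces_gt0 f k : continuous f -> affine_cover f `[0, 1] k ->
  (0 < affine_pieces f `[0%R, 1%R])%N.
Proof.
move=> cf ck; apply/(ltn_affine_pieces 0 cf); split=> //; exists k.
by move=> /(affine_cover_kinks ck); rewrite ltnn.
Qed.

(** On a piece of [f] the map is affine, hence monotone, so the preimage of an interval within that
    piece is again an interval; the slopes multiply. *)
Lemma affine_cover_comp f g I J k l : is_interval I -> (forall x, I x -> J (f x)) ->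
  affine_cover f I k -> affine_cover g J l -> affine_cover (g \o f) I (k * l).
Proof.
move=> iI IJ [T [F [Tk iF aF cF]]] [U [G [Ul iG aG cG]]].
exists (T * U)%type, (fun ij => F ij.1 `&` I `&` f @^-1` (G ij.2)); split=> //.
- by rewrite card_prod leq_mul.
- move=> [i j] x y /= [[Fx Ix] Gx] [[Fy Iy] Gy] z /andP[xz zy].
  have FIz : F i z /\ I z.
    by split; [apply: iF Fx Fy _ _|apply: iI Ix Iy _ _]; rewrite xz.
  split=> //; have [m [c fmc]] := aF i.
  (* The sign of the slope decides whether [f] preserves or reverses the order of [x], [z], [y]. *)
  have [m0|m0] := leP 0 m.
    by apply: iG Gx Gy _ _; rewrite !fmc// !lerD2r !ler_wpM2l.
  by apply: iG Gy Gx _ _; rewrite !fmc// !lerD2r !ler_wnM2l// ltW.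
- move=> [i j]; have [m [c fmc]] := aF i; have [n [b gnb]] := aG j.
  exists (n * m), (n * c + b) => x /= [[[Fx Ix] Gx] _].
  by rewrite gnb; [rewrite fmc//; ring|split=> //; exact: IJ].
- move=> x Ix; have [i Fix] := cF x Ix; have [j Gj] := cG (f x) (IJ x Ix).
  by exists (i, j).
Qed.

(** * Compositions of tent maps *)

Lemma tent_continuous (w : R * R) : continuous (tent w).
Proof.
move=> x; have -> : tent w =
  (fun=> 0) \max ((fun x => w.1 * x) \min (fun x => w.2 * (1 - x))) by [].
apply: continuous_max; first exact: cvg_cst.
apply: continuous_min.
  by apply: cvgM; [exact: cvg_cst|exact: cvg_id].
by apply: cvgM; [exact: cvg_cst|apply: cvgB; [exact: cvg_cst|exact: cvg_id]].
Qed.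

Lemma tent_comp_continuous (w : nat -> R * R) n : continuous (tent_comp w n).
Proof.
elim: n => [|n ih] x /=; first exact: cvg_id.
by apply: (@continuous_comp _ _ _ (tent_comp w n)); [exact: ih|exact: tent_continuous].
Qed.

Lemma tent_compD (w : nat -> R * R) n m x :
  tent_comp w (n + m) x = tent_comp (fun i => w (n + i)%N) m (tent_comp w n x).
Proof. by elim: m => [|m ih]; rewrite ?addn0// addnS /= ih. Qed.

Variable eps : R.

(** If both branches exceeded 1 at [x], then multiplying [a * x > 1] by [b] and [b * (1 - x) > 1] by
    [a] and adding would give [a * b > a + b], against a crossing height of at most 1. *)
Lemma tent_itv01 w x : param_set eps w -> 0 <= x <= 1 -> 0 <= tent w x <= 1.
Proof.
case: w => a b [/= a0 b0 _ _ h1] /andP[x0 x1]; rewrite /tent/=.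
rewrite le_max lexx/= ge_max ler01/= ge_min.
have {h1} ab : a * b <= a + b.
  by move: h1; rewrite /crossing_height ler_pdivrMr ?mul1r// addr_gt0.
have [//|ax] := leP (a * x) 1; have [//|bx] := leP (b * (1 - x)) 1.
suff : a + b < a * b by rewrite ltNge ab.
have : b * 1 < b * (a * x) by rewrite ltr_pM2l.
have : a * 1 < a * (b * (1 - x)) by rewrite ltr_pM2l.
by lra.
Qed.

Lemma tent_cover w : param_set eps w -> affine_cover (tent w) `[0, 1] 2.
Proof.
case: w => a b [/= a0 b0 _ _ _].
(* The two half-lines on either side of the apex, which they share. On [[0, 1]] both branches are
   nonnegative, so the outer maximum with 0 is inactive. *)
exists bool, (fun i => if i then [set x | a * x <= b * (1 - x)]
  else [set x | b * (1 - x) <= a * x]); split=> [||[]|x _].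
- by rewrite card_bool.
- move=> i x y; case: i => /= hx hy z /andP[xz zy].
    have : 0 <= (a + b) * (y - z) by rewrite mulr_ge0 ?subr_ge0// ltW// addr_gt0.
    by lra.
  have : 0 <= (a + b) * (z - x) by rewrite mulr_ge0 ?subr_ge0// ltW// addr_gt0.
  by lra.
- exists a, 0 => x/=; rewrite in_itv/= => -[xab /andP[x0 x1]].
  by rewrite /tent/= min_l// max_r ?addr0// mulr_ge0// ltW.
- exists (- b), b => x/=; rewrite in_itv/= => -[xab /andP[x0 x1]].
  by rewrite /tent/= min_r// max_r ?mulr_ge0 ?subr_ge0// ?ltW//; ring.
- by have [h|/ltW h] := leP (a * x) (b * (1 - x)); [exists true|exists false].
Qed.

Definition admissible (w : nat -> R * R) := forall i, param_set eps (w i).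

Lemma tent_comp_itv01 w n x : admissible w -> 0 <= x <= 1 ->
  0 <= tent_comp w n x <= 1.
Proof. by move=> aw x01; elim: n => //= n ih; exact: tent_itv01. Qed.

Lemma tent_comp_cover w n : admissible w ->
  affine_cover (tent_comp w n) `[0, 1] (2 ^ n).
Proof.
move=> aw; elim: n => [|n ih].
  exists unit, (fun=> setT); split=> //; first by rewrite card_unit.
  by move=> _; exists 1, 0 => x _ /=; rewrite mul1r addr0.
rewrite expnSr; apply: (@affine_cover_comp _ (tent (w n)) _ `[0, 1]%classic) => //.
- exact: interval_is_interval.
- by move=> x; rewrite /= !in_itv/=; exact: tent_comp_itv01.
- exact: tent_cover.
Qed.

(** The piece count as a function of the parameter path alone, so that it also applies to shifted
    paths. *)
Definition tent_pieces (w : nat -> R * R) n : nat := affine_pieces (tent_comp w n) `[0, 1].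

Lemma tent_pieces_gt0 w n : admissible w -> (0 < tent_pieces w n)%N.
Proof.
move=> aw; apply: affine_pieces_gt0 (tent_comp_cover n aw).
exact: tent_comp_continuous.
Qed.

Lemma tent_pieces_le w n : admissible w -> (tent_pieces w n <= 2 ^ n)%N.
Proof.
move=> aw; apply: (affine_cover_pieces _ (tent_comp_cover n aw)).2.
exact: tent_comp_continuous.
Qed.

Lemma tent_piecesD w n m : admissible w ->
  (tent_pieces w (n + m) <=
   tent_pieces w n * tent_pieces (fun i => w (n + i)%N) m)%N.
Proof.
move=> aw; apply: (affine_cover_pieces _ _).2; first exact: tent_comp_continuous.
rewrite (_ : tent_comp w (n + m) =
  tent_comp (fun i => w (n + i)%N) m \o tent_comp w n); last first.
  by apply/funext => x; rewrite tent_compD.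
apply: (@affine_cover_comp _ _ _ `[0, 1]%classic).
- exact: interval_is_interval.
- by move=> x; rewrite /= !in_itv/=; exact: tent_comp_itv01.
- have cw := @tent_comp_continuous w n.
  exact: (affine_cover_pieces cw (tent_comp_cover n aw)).1.
- have cw := @tent_comp_continuous (fun i => w (n + i)%N) m.
  by apply: (affine_cover_pieces cw (tent_comp_cover m _)).1 => i; exact: aw.
Qed.

End affine_pieces.

(** * Measurability of the number of pieces *)

Section measurability.
Context {R : realType} {d : measure_display} {T : measurableType d}.

Lemma measurable_tent_comp (w : T -> nat -> R * R) n x :
  (forall i, (i < n)%N -> measurable_fun [set: T] (w^~ i)) ->
  measurable_fun [set: T] (fun t => tent_comp (w t) n x).
Proof.
elim: n => [_|n ih mw /=]; first exact: measurable_cst.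
have {ih} mF : measurable_fun [set: T] (fun t => tent_comp (w t) n x).
  by apply: ih => i ni; apply: mw; exact: ltnW.
have mwn := mw n (ltnSn n).
apply: measurable_maxr; first exact: measurable_cst.
apply: measurable_minr.
  by apply: measurable_funM => //; exact: measurableT_comp measurable_fst mwn.
apply: measurable_funM; first exact: measurableT_comp measurable_snd mwn.
by apply: measurable_funB.
Qed.

Lemma measurable_nat_fun (N : T -> nat) :
  (forall k, measurable [set t | (k < N t)%N]) -> measurable_fun [set: T] N.
Proof.
move=> mN _ Y _; rewrite setTI.
have -> : N @^-1` Y = \bigcup_(k in Y) N @^-1` [set k].
  by apply/seteqP; split=> [t Yt|t [k Yk /= ->]//]; exists (N t).
apply: bigcup_measurable => -[|k] _.
  rewrite (_ : N @^-1` _ = ~` [set t | (0 < N t)%N]); first exact: measurableC.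
  by apply/seteqP; split=> t /=; [move=> ->|move/negP; rewrite -leqNgt leqn0 => /eqP].
rewrite (_ : N @^-1` _ = [set t | (k < N t)%N] `\` [set t | (k.+1 < N t)%N]).
  exact: measurableD.
apply/seteqP; split=> t /=; first by move=> ->; rewrite ltnSn ltnn.
by move=> [kN /negP]; rewrite -leqNgt => Nk; apply/eqP; rewrite eqn_leq Nk.
Qed.

Variable f : T -> R -> R.
Hypothesis cf : forall t, continuous (f t).
Hypothesis mf : forall x, measurable_fun [set: T] (f^~ x).

Lemma measurable_affine_on p s : p < s ->
  measurable [set t | affine_on (f t) `[p, s]].
Proof.
move=> ps; pose g r t : R :=
  (s - p) * f t (ratr r) - (s - ratr r) * f t p - (ratr r - p) * f t s.
rewrite (_ : mkset _ =
  ~` \bigcup_(r in [set r : rat | p < ratr r < s]) (g r @^-1` [set~ 0])).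
  apply: measurableC; rewrite bigcup_mkcond.
  apply: bigcupT_measurable_rat => r; case: ifP => // _.
  rewrite -[X in measurable X]setTI; have : measurable_fun [set: T] (g r).
    by repeat apply: measurable_funB; apply: measurable_funM.
  by apply => //; apply: measurableC.
rewrite setC_bigcup; apply/seteqP; split=> t /=.
  by move=> /(affine_on_itv_ratP (@cf t) ps) h r /h gr0 /(_ gr0).
by move=> h; apply/(affine_on_itv_ratP (@cf t) ps) => r /h /contrapT.
Qed.

Lemma measurable_kinks k (p : rat) :
  measurable [set t | kinks (f t) k (ratr p)].
Proof.
elim: k p => [p|k ih p /=]; first by rewrite (_ : mkset _ = setT)//; exact/seteqP.
rewrite (_ : mkset _ =
  \bigcup_(s in [set s : rat | ratr p < (ratr s : R) <= 1])
    (~` [set t | affine_on (f t) `[ratr p, ratr s]] `&`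
     [set t | kinks (f t) k (ratr s)])); last first.
  by apply/seteqP; split=> [t [s [ps1 ? ?]]|t [s ps1 [? ?]]]; exists s.
rewrite bigcup_mkcond; apply: bigcupT_measurable_rat => s.
case: ifPn => // /set_mem /= /andP[ps _]; apply: measurableI => //.
by apply: measurableC; exact: measurable_affine_on.
Qed.

Lemma measurable_affine_pieces :
  measurable_fun [set: T] (fun t => affine_pieces (f t) `[0, 1]).
Proof.
apply: measurable_nat_fun => k.
(* The union over [j] is the event that a finite affine partition exists. *)
rewrite (_ : mkset _ = [set t | kinks (f t) k 0] `&`
  \bigcup_j ~` [set t | kinks (f t) j 0]); last first.
  apply/seteqP; split=> t /=.
    by move/(ltn_affine_pieces k (@cf t)) => [kt [j nj]]; split=> //; exists j.
  move=> [kt [j _ nj]]; apply/(ltn_affine_pieces k (@cf t)).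
  by split=> //; exists j.
have mk j : measurable [set t | kinks (f t) j 0].
  by have := measurable_kinks j 0%Q; rewrite rmorph0.
apply: measurableI => //.
by apply: bigcupT_measurable => j; exact: measurableC.
Qed.

End measurability.

Lemma measurable_tent_pieces {R : realType} {d : measure_display}
    {T : measurableType d} (w : T -> nat -> R * R) n :
  (forall i, (i < n)%N -> measurable_fun [set: T] (w^~ i)) ->
  measurable_fun [set: T] (fun t => tent_pieces (w t) n).
Proof.
move=> mw; apply: measurable_affine_pieces.
  by move=> t; exact: tent_comp_continuous.
by move=> x; exact: measurable_tent_comp.
Qed.

(** * Independence of the head and the tail of an i.i.d. sequence *)

Section iid_sequences.
Context {R : realType} {d : measure_display} {Omega : measurableType d}.
Context {d' : measure_display} {T : measurableType d'}.

(** Generators of the sigma-algebra of the first [n] coordinates. They form a pi-system containing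
    the whole space, as uniqueness of measures requires, and live on infinite paths, to which
    [tent_pieces] applies directly. *)
Definition cylinder (n : nat) : set (set (nat -> T)) :=
  [set A | exists2 E : nat -> set T, forall i, measurable (E i) &
     A = [set w | forall i, (i < n)%N -> E i (w i)]].

Lemma cylinder_setI n : setI_closed (cylinder n).
Proof.
move=> _ _ [E mE ->] [F mF ->]; exists (fun i => E i `&` F i).
  by move=> i; exact: measurableI.
apply/seteqP; split=> w; first by move=> [Ew Fw] i ni; split; [exact: Ew|exact: Fw].
by move=> EFw; split=> i /EFw[].
Qed.

Lemma cylinder_setT n : cylinder n setT.
Proof. by exists (fun=> setT) => //; apply/seteqP; split. Qed.

Lemma measurable_coordinate n i : (i < n)%N ->
  measurable_fun [set: g_sigma_algebraType (cylinder n)] (fun w => w i : T).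
Proof.
move=> ni _ B mB; rewrite setTI; apply: sub_sigma_algebra.
exists (fun j => if j == i then B else setT); first by move=> j; case: ifP.
apply/seteqP; split=> w /=; first by move=> Bwi j _; case: eqP => [->|].
by move=> /(_ i ni); rewrite eqxx.
Qed.

Variables (P : probability Omega R) (mu : probability T R).
Variable X : nat -> {mfun Omega >-> T}.
Hypothesis iidX : iid_with_law P X mu.

Definition tail_path k (t : Omega) : nat -> T := fun i => X (k + i)%N t.

Lemma measurable_tail_path k n : measurable_fun [set: Omega]
  (tail_path k : Omega -> g_sigma_algebraType (cylinder n)).
Proof.
apply: (@measurability _ _ _ (g_sigma_algebraType (cylinder n)) _ _ (cylinder n)) => //= _ [_ [E mE ->] <-].
rewrite setTI (_ : _ @^-1` _ =
  \bigcap_i if (i < n)%N then X (k + i) @^-1` E i else setT); last first.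
  apply/seteqP; split=> t /=; first by move=> Et i _; case: ifP => // /Et.
  by move=> h i ni; have := h i Logic.I; rewrite ni.
apply: bigcapT_measurable => i; case: ifP => // _.
exact: measurable_funPTI.
Qed.

Lemma iid_finite_prod (H : nat -> set T) n : (forall i, measurable (H i)) ->
  (P [set t | forall i, (i < n)%N -> H i (X i t)] = \prod_(i < n) mu (H i))%E.
Proof.
move=> mH; have [law indep] := iidX.
transitivity (P (\bigcap_(i in [set` iota 0 n]) (X i @^-1` H i))).
  congr (P _); apply/seteqP; split=> t /= h i.
    by rewrite /= mem_iota add0n => /h.
  by move=> ni; apply: h; rewrite /= mem_iota.
rewrite (indep _ _ (iota_uniq 0 n) mH) -(big_mkord xpredT (fun i => mu (H i))).
by rewrite /index_iota subn0; apply: eq_bigr => i _; rewrite -(law i).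
Qed.

(** Uniqueness of finite measures on a pi-system, applied to the two pushforwards. *)
Lemma cylinder_measure_unique n (m1 m2 : measure Omega R)
    (f1 f2 : Omega -> g_sigma_algebraType (cylinder n)) :
  measurable_fun [set: Omega] f1 -> measurable_fun [set: Omega] f2 ->
  (m1 setT < +oo)%E ->
  (forall C, cylinder n C -> m1 (f1 @^-1` C) = m2 (f2 @^-1` C)) ->
  forall C, <<s cylinder n >> C -> m1 (f1 @^-1` C) = m2 (f2 @^-1` C).
Proof.
move=> mf1 mf2 m1oo m12.
apply: (@measure_unique _ _ (g_sigma_algebraType (cylinder n)) (cylinder n)
  (fun=> setT) _ _ _ _ (pushforward m1 f1) (pushforward m2 f2)) => //.
- exact: cylinder_setI.
- by move=> _; exact: cylinder_setT.
- exact: bigcup_const.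
Qed.

(** The two conditions glue to one cylinder of length [n + m], whose probability is a product over
    coordinates. The last [m] factors are those of the unshifted path, because the coordinates share
    one law; hence [tail_path 0] in both factors. *)
Lemma head_tail_cylinder n m (A B : set (nat -> T)) : cylinder n A -> cylinder m B ->
  (P (tail_path 0 @^-1` A `&` tail_path n @^-1` B) =
   P (tail_path 0 @^-1` A) * P (tail_path 0 @^-1` B))%E.
Proof.
move=> [E mE ->] [F mF ->].
have mEF i : measurable (if (i < n)%N then E i else F (i - n)%N) by case: ifP.
transitivity (P [set t | forall i, (i < n + m)%N ->
    (if (i < n)%N then E i else F (i - n)%N) (X i t)]).
  congr (P _); apply/seteqP; split=> t /=.
    move=> [Et Ft] i inm; case: ltnP => [/Et//|ni].
    have := Ft (i - n)%N; rewrite /tail_path subnKC//; apply.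
    by rewrite ltn_subLR.
  move=> h; split=> i ilt; first by have := h i (ltn_addr _ ilt); rewrite ilt.
  have := h (n + i)%N; rewrite ltn_add2l => /(_ ilt).
  by rewrite ltnNge leq_addr/= addKn.
rewrite (iid_finite_prod _ mEF) big_split_ord/=; congr (_ * _)%E.
  by rewrite (iid_finite_prod _ mE)//; apply: eq_bigr => i _; rewrite ltn_ord.
rewrite (iid_finite_prod _ mF)//; apply: eq_bigr => i _.
by rewrite ltnNge leq_addr/= addKn.
Qed.

(** The identity extends from cylinders one argument at a time: with the other set fixed, both sides
    are finite measures, namely a restriction of [P] and a multiple of [P], pushed forward to
    paths. *)
Lemma head_tail_indep n m (A B : set (nat -> T)) :
  <<s cylinder n >> A -> <<s cylinder m >> B ->
  (P (tail_path 0 @^-1` A `&` tail_path n @^-1` B) =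
   P (tail_path 0 @^-1` A) * P (tail_path 0 @^-1` B))%E.
Proof.
have mpath k l C : <<s cylinder l >> C -> measurable (tail_path k @^-1` C).
  by move=> lC; have := measurable_tail_path k measurableT lC; rewrite setTI.
(* The probability of [C] as a nonnegative real, the form of factor that [mscale] takes. *)
pose r C : {nonneg R} := NngNum (fine_ge0 (measure_ge0 P C)).
have rE C : measurable C -> ((r C)%:num%:E = P C)%E.
  by move=> mC; rewrite /= fineK// fin_num_measure.
have P_lty (D : set Omega) : measurable D -> (P (setT `&` D) < +oo)%E.
  by move=> mD; rewrite setTI -ge0_fin_numE// fin_num_measure.
move=> sA sB; have mA := mpath 0%N _ _ sA; have mB := mpath 0%N _ _ sB.
have mnB := mpath n _ _ sB.
have head_cylinder C : cylinder n C ->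
    P (tail_path 0 @^-1` C `&` tail_path n @^-1` B) =
    (P (tail_path 0 @^-1` C) * P (tail_path 0 @^-1` B))%E.
  move=> nC; have mC : measurable (tail_path 0 @^-1` C).
    by apply: (mpath 0%N n); exact: sub_sigma_algebra.
  rewrite setIC -(rE _ mC); move: B sB {mB mnB}.
  apply: (cylinder_measure_unique (m1 := mrestr P mC) (m2 := mscale (r _) P))
    => //; [exact: measurable_tail_path|exact: measurable_tail_path| |].
  - exact: P_lty.
  - move=> F mF; rewrite /= /mrestr setIC (head_tail_cylinder nC mF).
    by rewrite /mscale rE.
rewrite muleC -(rE _ mB); move: A sA {mA}.
apply: (cylinder_measure_unique (m1 := mrestr P mnB) (m2 := mscale (r _) P))
  => //; [exact: measurable_tail_path|exact: measurable_tail_path| |].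
- exact: P_lty.
- by move=> E mE; rewrite /= /mrestr head_cylinder// /mscale rE// muleC.
Qed.

Lemma expectation_head_tail n m (f g : (nat -> T) -> R) :
  measurable_fun [set: g_sigma_algebraType (cylinder n)] f ->
  measurable_fun [set: g_sigma_algebraType (cylinder m)] g ->
  (forall w, 0 <= f w) -> (forall w, 0 <= g w) ->
  ('E_P[fun t => (f (tail_path 0 t) * g (tail_path n t))%R] =
   'E_P[f \o tail_path 0] * 'E_P[g \o tail_path 0])%E.
Proof.
move=> mf mg f0 g0.
pose h k l : {mfun Omega >-> g_sigma_algebraType (cylinder l)} :=
  mfun_Sub (mem_set (@measurable_tail_path k l)).
have mh : measurable_fun [set: Omega] (fun t => (h 0%N n t, h n m t)).
  exact: measurable_fun_pair.
pose hh : {mfun Omega >-> _} := mfun_Sub (mem_set mh).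
rewrite unlock.
transitivity (\int[distribution P hh]_z (f z.1 * g z.2)%:E)%E.
  rewrite ge0_integral_distribution//; last first.
    by move=> z; rewrite lee_fin mulr_ge0.
  apply/measurable_EFinP; apply: measurable_funM.
    exact: measurableT_comp mf measurable_fst.
  exact: measurableT_comp mg measurable_snd.
(* The joint law of head and tail is a product, since the two measures agree on rectangles.
   Tonelli's theorem then separates the integrals. *)
rewrite (eq_measure_integral (distribution P (h 0%N n) \x distribution P (h 0%N m))%E);
  last first.
  move=> A mA _; apply/esym/(@product_measure_unique _ _ _ _ _ _ _ (distribution P hh)) => //.
  by move=> B C mB mC; exact: head_tail_indep mB mC.
rewrite fubini_tonelli1//=; last 2 first.
- apply/measurable_EFinP; apply: measurable_funM.
    exact: measurableT_comp mf measurable_fst.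
  exact: measurableT_comp mg measurable_snd.
- by move=> z; rewrite lee_fin mulr_ge0.
pose c := (\int[P]_t (g (tail_path 0 t))%:E)%E.
have gE : (\int[distribution P (h 0%N m)]_y (g y)%:E = c)%E.
  rewrite ge0_integral_distribution//.
  exact/measurable_EFinP.
have c0 : (0 <= c)%E by apply: integral_ge0 => t _; rewrite lee_fin.
transitivity (\int[distribution P (h 0%N n)]_x ((f x)%:E * c))%E.
  apply: eq_integral => x _; rewrite /fubini_F /= -gE -ge0_integralZl//;
    by [exact/measurable_EFinP|move=> y _; rewrite lee_fin|rewrite lee_fin].
rewrite ge0_integralZr//;
  [|exact/measurable_EFinP|by move=> x _; rewrite lee_fin].
rewrite ge0_integral_distribution//.
exact/measurable_EFinP.
Qed.

End iid_sequences.

(** * Growth of the moments *)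

(** Fekete's lemma; the lower bound [c] keeps the infimum finite. Choose [k] whose quotient is
    within [e / 2] of the infimum and divide [n] by [k] with remainder: the error is bounded in [n],
    so dividing by [n] removes it. *)
Lemma subadditive_cvg {R : realType} (u : nat -> R) (c : R) :
  (forall n m, u (n + m)%N <= u n + u m) -> (forall n, n%:R * c <= u n) ->
  (fun n => n%:R^-1 * u n) @ \oo -->
    inf [set n%:R^-1 * u n | n in [set n | (1 <= n)%N]].
Proof.
move=> usub uc; set S := [set _ | _ in _]; set l := inf S.
have S0 : S !=set0 by exists (1%:R^-1 * u 1), 1%N.
have lbS : has_lbound S.
  exists c => _ [n /= n1 <-]; have n0 : 0 < n%:R :> R by rewrite ltr0n.
  by rewrite -(ler_pM2l n0) mulVKf ?gt_eqF.
have usubM k a r : u (a * k + r)%N <= a%:R * u k + u r.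
  elim: a => [|a ih]; first by rewrite mul0n mul0r add0r.
  rewrite mulSn -addnA (le_trans (usub _ _))// -natr1 mulrDl mul1r.
  by lra.
apply/cvgrPdist_lt => e e0.
have e20 : 0 < e / 2 by rewrite divr_gt0.
have [_ [k /= k1 <-] vl] := inf_adherent e20 (conj S0 lbS).
set v := k%:R^-1 * u k in vl.
have k0 : 0 < k%:R :> R by rewrite ltr0n.
(* The sum bounds [u] at the remainder; the last term pays for replacing the multiple of [k] by [n]
   in front of [v]. *)
pose B : R := \sum_(r < k) `|u r| + k%:R * `|v|.
have ub n : u n <= n%:R * v + B.
  have rk : (n %% k < k)%N by rewrite ltn_mod.
  have ur : u (n %% k)%N <= \sum_(r < k) `|u r|.
    rewrite (bigD1 (Ordinal rk))//= (le_trans (ler_norm _))// lerDl.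
    by rewrite sumr_ge0.
  rewrite {1}(divn_eq n k) (le_trans (usubM _ _ _))//.
  have -> : u k = k%:R * v by rewrite /v mulVKf ?gt_eqF.
  have -> : n%:R = (n %/ k)%:R * k%:R + (n %% k)%:R :> R.
    by rewrite -natrM -natrD -divn_eq.
  have : (n %% k)%:R * (- v) <= k%:R * `|v|.
    rewrite (le_trans (ler_norm _))// normrM normrN normr_nat.
    by rewrite ler_wpM2r// ler_nat ltnW.
  by rewrite /B; lra.
near=> n.
have n1 : (1 <= n)%N by near: n; exists 1%N.
have n0 : 0 < n%:R :> R by rewrite ltr0n.
have ln : l <= n%:R^-1 * u n by apply: ge_inf => //; exists n.
rewrite distrC ger0_norm ?subr_ge0//.
have Bn : n%:R^-1 * B < e / 2.
  rewrite mulrC ltr_pdivrMr// mulrC -ltr_pdivrMr//.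
  by near: n; exact: nbhs_infty_gtr.
have := ub n; rewrite -(ler_pM2l (_ : 0 < n%:R^-1)) ?invr_gt0//.
by rewrite mulrDr mulKf ?gt_eqF//; lra.
Unshelve. all: by end_near. Qed.

(** The graph lies above its tangent at [z]; in the weighted sum of the tangent bounds at [x] and
    [y] the linear terms cancel. *)
Lemma expR_convex_comb {R : realType} (s x y : R) : 0 <= s -> s <= 1 ->
  expR (s * x + (1 - s) * y) <= s * expR x + (1 - s) * expR y.
Proof.
move=> s0 s1; set z := s * x + _.
have tangent t : expR z * (1 + (t - z)) <= expR t.
  by rewrite -[X in _ <= expR X](subrKC z t) [leRHS]expRD ler_wpM2l ?expR_ge0// expR_ge1Dx.
have s1' : 0 <= 1 - s by rewrite subr_ge0.
have := lerD (ler_wpM2l s0 (tangent x)) (ler_wpM2l s1' (tangent y)).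
by apply: le_trans; rewrite le_eqVlt; apply/orP; left; apply/eqP; rewrite /z; ring.
Qed.

(** * Moments of the number of pieces: bounds, factorization, convexity and Chernoff's inequality *)

Section moments.
Context {R : realType} (eps : R) {mu : probability (R * R)%type R}.
Hypothesis mu_supp : mu (param_set eps) = 1%E.
Context {d : measure_display} {Omega : measurableType d} (P : probability Omega R).
Variable omega : nat -> {mfun Omega >-> (R * R)%type}.
Hypothesis iid_omega : iid_with_law P omega mu.

Local Notation N := (piece_count omega).

Lemma measurable_param_set : measurable (param_set eps).
Proof.
have m1 : measurable_fun [set: R * R] (@fst R R) by exact: measurable_fst.
have m2 : measurable_fun [set: R * R] (@snd R R) by exact: measurable_snd.
(* The crossing height condition is multiplied out by the positive [w.1 + w.2], leaving only
   comparisons of polynomials and absolute values. *)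
pose b (w : R * R) := [&& 0 < w.1, 0 < w.2, `|w.1 - 2| <= eps,
  `|w.2 - 2| <= eps & w.1 * w.2 <= w.1 + w.2].
rewrite (_ : param_set eps = b @^-1` [set true]); last first.
  apply/seteqP; split=> w; rewrite /b /param_set /crossing_height /=.
    by case=> w1 w2 -> -> + /=; rewrite w1 w2 ler_pdivrMr ?addr_gt0// mul1r.
  by case/and5P=> w1 w2 -> -> h; split=> //; rewrite ler_pdivrMr ?addr_gt0// mul1r.
rewrite -[X in measurable X]setTI.
have : measurable_fun setT b; last by apply.
apply: measurable_and; first exact: measurable_fun_ltr.
apply: measurable_and; first exact: measurable_fun_ltr.
apply: measurable_and.
  apply: measurable_fun_ler => //; apply: measurableT_comp => //.
  exact: measurable_funB.
apply: measurable_and.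
  apply: measurable_fun_ler => //; apply: measurableT_comp => //.
  exact: measurable_funB.
by apply: measurable_fun_ler; [exact: measurable_funM|exact: measurable_funD].
Qed.

Lemma ae_admissible : \forall t \ae P, admissible eps (fun k => omega k t).
Proof.
apply: ae_foralln => k; exists (omega k @^-1` (~` param_set eps)); split=> //.
- by apply: measurable_funPTI; apply: measurableC; exact: measurable_param_set.
- have mC := measurableC measurable_param_set.
  have [law _] := iid_omega; have := law k _ mC.
  rewrite /distribution/pushforward /= => ->.
  rewrite probability_setC; last exact: measurable_param_set.
  by rewrite mu_supp subee.
Qed.

Lemma measurable_piece_count n : measurable_fun [set: Omega] (N n).
Proof. by apply: measurable_tent_pieces => i _; exact: measurable_funPT. Qed.

Lemma measurable_piece_powR n q :
  measurable_fun [set: Omega] (fun t => (N n t)%:R `^ q : R).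
Proof.
exact: (measurableT_comp (_ : measurable_fun [set: nat] (fun k => k%:R `^ q : R))
  (measurable_piece_count n)).
Qed.

Lemma ln_piece_count n t : admissible eps (fun k => omega k t) ->
  0 <= (ln (N n t)%:R : R) <= n%:R * ln 2.
Proof.
move=> adm; have N1 : (1 <= N n t)%N by exact: (tent_pieces_gt0 n adm).
have N2 : (N n t <= 2 ^ n)%N by exact: (tent_pieces_le n adm).
rewrite ln_ge0 ?ler1n//= mulr_natl -lnXn// ler_ln ?posrE ?exprn_gt0 ?ltr0n//.
by rewrite -natrX ler_nat.
Qed.

Lemma piece_powR n t q : admissible eps (fun k => omega k t) ->
  (N n t)%:R `^ q = expR (q * ln (N n t)%:R) :> R.
Proof.
move=> adm; have N1 : (0 < N n t)%N by exact: (tent_pieces_gt0 n adm).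
by rewrite /powR pnatr_eq0 gtn_eqF.
Qed.

Lemma piece_powRD n m t q : admissible eps (fun k => omega k t) ->
  let ab := (N n t)%:R `^ q *
    (tent_pieces (tail_path omega n t) m)%:R `^ q : R in
  (0 <= q -> (N (n + m) t)%:R `^ q <= ab) /\
  (q <= 0 -> ab <= (N (n + m) t)%:R `^ q).
Proof.
move=> adm ab; have N0 : (0 < N n t)%N by exact: (tent_pieces_gt0 n adm).
have N'0 : (0 < tent_pieces (tail_path omega n t) m)%N.
  by apply: (@tent_pieces_gt0 _ eps) => i; exact: adm.
have Nnm0 : (0 < N (n + m) t)%N by exact: (tent_pieces_gt0 _ adm).
have Nab : (N (n + m) t <= N n t * tent_pieces (tail_path omega n t) m)%N.
  exact: (tent_piecesD n m adm).
have lnle : ln (N (n + m) t)%:R <=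
    ln (N n t)%:R + ln (tent_pieces (tail_path omega n t) m)%:R :> R.
  rewrite -lnM ?posrE ?ltr0n// -natrM.
  by rewrite ler_ln ?posrE ?ltr0n ?muln_gt0 ?N0// ler_nat.
rewrite /ab /powR !pnatr_eq0 !gtn_eqF// -expRD -mulrDr !ler_expR.
by split=> q0; [rewrite ler_wpM2l|rewrite ler_wnM2l].
Qed.

Definition moment q n : \bar R := 'E_P[fun t => ((N n t)%:R `^ q)%R]%E.

Lemma le_moment_cst q n c : 0 <= c ->
  (forall t, admissible eps (fun k => omega k t) -> (N n t)%:R `^ q <= c) ->
  (moment q n <= c%:E)%E.
Proof.
move=> c0 Nc; rewrite -(expectation_cst P c); apply: expectation_le => //.
- exact: measurable_piece_powR.
- by apply: filterS ae_admissible => t; exact: Nc.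
Qed.

Lemma ge_moment_cst q n c : 0 <= c ->
  (forall t, admissible eps (fun k => omega k t) -> c <= (N n t)%:R `^ q) ->
  (c%:E <= moment q n)%E.
Proof.
move=> c0 Nc; rewrite -(expectation_cst P c); apply: expectation_le => //.
- exact: measurable_piece_powR.
- by apply: filterS ae_admissible => t; exact: Nc.
Qed.

Lemma moment_bounds q n :
  ((expR (n%:R * Num.min 0 (q * ln 2)))%:E <= moment q n <=
   (expR (n%:R * Num.max 0 (q * ln 2)))%:E)%E.
Proof.
have nln2 : 0 <= n%:R * ln 2 :> R by rewrite mulr_ge0// ln_ge0// ler1n.
apply/andP; split.
  apply: ge_moment_cst => [|t adm]; first exact: expR_ge0.
  rewrite piece_powR// ler_expR; have /andP[ln0 lnn] := ln_piece_count n adm.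
  have [q0|/ltW q0] := leP 0 q.
    rewrite (@le_trans _ _ 0)// ?mulr_ge0//.
    by rewrite mulr_ge0_le0// ge_min lexx.
  apply: (@le_trans _ _ (q * (n%:R * ln 2))); last by rewrite ler_wnM2l.
  by rewrite mulrCA ler_wpM2l// ge_min lexx orbT.
apply: le_moment_cst => [|t adm]; first exact: expR_ge0.
rewrite piece_powR// ler_expR; have /andP[ln0 lnn] := ln_piece_count n adm.
have [q0|/ltW q0] := leP 0 q.
  apply: (@le_trans _ _ (q * (n%:R * ln 2))); first by rewrite ler_wpM2l.
  by rewrite mulrCA ler_wpM2l// le_max lexx orbT.
rewrite (@le_trans _ _ 0)// ?mulr_le0_ge0//.
by rewrite mulr_ge0// le_max lexx.
Qed.

(** By [moment_bounds] the moment is finite and positive, so the passage to real numbers loses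
    nothing. *)
Definition log_moment q n : R := ln (fine (moment q n)).

Lemma momentE q n : moment q n = (expR (log_moment q n))%:E.
Proof.
have /andP[h1 h2] := moment_bounds q n.
have fm : moment q n \is a fin_num.
  rewrite ge0_fin_numE ?(le_lt_trans h2) ?ltry//.
  by rewrite (le_trans _ h1)// lee_fin expR_ge0.
rewrite /log_moment lnK ?fineK// posrE fine_gt0//.
by rewrite (lt_le_trans _ h1) ?lte_fin ?expR_gt0//= -ge0_fin_numE// (le_trans _ h1)// lee_fin expR_ge0.
Qed.

Lemma log_moment_bounds q n : n%:R * Num.min 0 (q * ln 2) <= log_moment q n <=
  n%:R * Num.max 0 (q * ln 2).
Proof. by have := moment_bounds q n; rewrite momentE !lee_fin !ler_expR. Qed.

Lemma scaled_log_momentE q n :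
  scaled_log_moment P omega q n = (n%:R^-1 * log_moment q n)%:E.
Proof.
rewrite /scaled_log_moment -/(moment q n) momentE lne_EFin ?expR_gt0//.
by rewrite expRK EFinM.
Qed.

(** Independence and the common law enter the moment estimates here, and the factorization is exact;
    the inequality in [log_momentD] comes only from the pointwise comparison. *)
Lemma moment_shiftE q n m :
  ('E_P[fun t => ((N n t)%:R `^ q *
     (tent_pieces (tail_path omega n t) m)%:R `^ q)%R] =
   moment q n * moment q m)%E.
Proof.
have mt k : measurable_fun [set: g_sigma_algebraType (@cylinder _ (R * R)%type k)]
    (fun w : nat -> R * R => (tent_pieces w k)%:R `^ q : R).
  apply: (measurableT_comp (_ : measurable_fun [set: nat]
    (fun j => j%:R `^ q : R))) => //.
  by apply: measurable_tent_pieces => i; exact: measurable_coordinate.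
by rewrite (expectation_head_tail iid_omega (mt n) (mt m))// => w; exact: powR_ge0.
Qed.

Lemma log_momentD q n m :
  (0 <= q -> log_moment q (n + m) <= log_moment q n + log_moment q m) /\
  (q <= 0 -> log_moment q n + log_moment q m <= log_moment q (n + m)).
Proof.
have mN := measurable_piece_powR; have N0 k t := powR_ge0 ((N k t)%:R : R) q.
have mNN : measurable_fun [set: Omega] (fun t => (N n t)%:R `^ q *
    (tent_pieces (tail_path omega n t) m)%:R `^ q : R).
  apply: measurable_funM => //.
  apply: (measurableT_comp (_ : measurable_fun [set: nat]
    (fun j => j%:R `^ q : R))) => //.
  by apply: measurable_tent_pieces => i _; exact: measurable_funPT.
have NN0 t : 0 <= (N n t)%:R `^ q *
    (tent_pieces (tail_path omega n t) m)%:R `^ q :> R.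
  by rewrite mulr_ge0 ?powR_ge0.
have shiftE := moment_shiftE q n m.
rewrite (momentE q n) (momentE q m) -EFinM -expRD in shiftE.
split=> q0; rewrite -ler_expR -lee_fin -shiftE -(momentE q (n + m)).
  apply: expectation_le => //; apply: filterS ae_admissible => t adm.
  exact: (piece_powRD n m q adm).1.
apply: expectation_le => //; apply: filterS ae_admissible => t adm.
exact: (piece_powRD n m q adm).2.
Qed.

Lemma expectationZl_ge0 (f : Omega -> R) c : 0 <= c ->
  measurable_fun [set: Omega] f -> (forall t, 0 <= f t) ->
  ('E_P[fun t => (c * f t)%R] = c%:E * 'E_P[f])%E.
Proof.
move=> c0 mf f0; rewrite unlock -ge0_integralZl//.
  exact/measurable_EFinP.
by move=> t _; rewrite lee_fin.
Qed.

Lemma expectationD_ge0 (f g : Omega -> R) :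
  measurable_fun [set: Omega] f -> (forall t, 0 <= f t) ->
  measurable_fun [set: Omega] g -> (forall t, 0 <= g t) ->
  ('E_P[fun t => (f t + g t)%R] = 'E_P[f] + 'E_P[g])%E.
Proof.
move=> mf f0 mg g0; rewrite unlock -ge0_integralD//.
- by move=> t _; rewrite lee_fin.
- exact/measurable_EFinP.
- by move=> t _; rewrite lee_fin.
- exact/measurable_EFinP.
Qed.

(* Hoelder's inequality, from the convexity of the exponential applied to
   [p * ln N - log_moment p] and [q * ln N - log_moment q]. *)
Lemma log_moment_convex n (p q s : R) : 0 <= s -> s <= 1 ->
  log_moment (s * p + (1 - s) * q) n <=
  s * log_moment p n + (1 - s) * log_moment q n.
Proof.
move=> s0 s1; have s1' : 0 <= 1 - s by rewrite subr_ge0.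
rewrite -ler_expR -lee_fin -(momentE _ n).
have := momentE p n; have := momentE q n.
move: (log_moment p n) (log_moment q n) => x y Eq Ep.
set r := s * p + _; set u := s * x + _.
(* The weights [a] and [b] are chosen so that [a] times the moment of order [p] plus [b] times that
   of order [q] is exactly [expR u]. *)
have [a [a0 aE]] : exists a, 0 <= a /\ a = s * expR (u - x).
  by exists (s * expR (u - x)); rewrite mulr_ge0 ?expR_ge0.
have [b [b0 bE]] : exists b, 0 <= b /\ b = (1 - s) * expR (u - y).
  by exists ((1 - s) * expR (u - y)); rewrite mulr_ge0 ?expR_ge0.
have Nab t : admissible eps (fun k => omega k t) ->
    (N n t)%:R `^ r <= a * (N n t)%:R `^ p + b * (N n t)%:R `^ q.
  move=> adm; rewrite !piece_powR//; move: (ln _) => L.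
  (* The constants cancel in the convex combination, because [u] is the same combination of [x] and
     [y]; what remains is [r * L]. *)
  have := expR_convex_comb (u - x + p * L) (u - y + q * L) s0 s1.
  rewrite !(expRD (u - _)) !mulrA -aE -bE; apply: le_trans.
  by rewrite ler_expR /r /u; lra.
have mf c v : measurable_fun [set: Omega] (fun t => c * (N n t)%:R `^ v : R).
  by apply: measurable_funM; [exact: measurable_cst|exact: measurable_piece_powR].
have f0 c v t : 0 <= c -> 0 <= c * (N n t)%:R `^ v :> R.
  by move=> c0; apply: mulr_ge0; [exact: c0|exact: powR_ge0].
have -> : (expR u)%:E =
    'E_P[fun t => (a * (N n t)%:R `^ p + b * (N n t)%:R `^ q)%R]%E.
  rewrite expectationD_ge0; [|exact: mf|by move=> t; exact: f0|exact: mf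
    |by move=> t; exact: f0].
  rewrite (expectationZl_ge0 a0 (measurable_piece_powR n p));
    last by move=> t; exact: powR_ge0.
  rewrite (expectationZl_ge0 b0 (measurable_piece_powR n q));
    last by move=> t; exact: powR_ge0.
  rewrite -/(moment p n) -/(moment q n) Ep Eq -!EFinM -EFinD; congr _%:E.
  by rewrite aE bE -!mulrA -!expRD !subrK; ring.
apply: expectation_le.
- exact: measurable_piece_powR.
- by apply: measurable_funD; exact: mf.
- by move=> t; exact: powR_ge0.
- by move=> t; apply: addr_ge0; exact: f0.
- by apply: filterS ae_admissible => t; exact: Nab.
Qed.

(** On the event, the power of order [q] of the count is almost surely at least
    [expR (n%:R * (q * x))], and Markov's argument applies. Stating it for a set [K] of counts
    treats both tails at once, the sign of [q] being hidden in the hypothesis. *)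
Lemma chernoff q x n (K : set nat) :
  (forall k, K k -> (0 < k)%N -> n%:R * (q * x) <= q * ln k%:R) ->
  (P (N n @^-1` K) <= (expR (log_moment q n - n%:R * (q * x)))%:E)%E.
Proof.
move=> Kq; have mK : measurable (N n @^-1` K).
  by have := measurable_piece_count n measurableT (_ : measurable K); rewrite setTI; apply.
set c := expR (n%:R * (q * x)).
have c0 : 0 < c by exact: expR_gt0.
have : (c%:E * P (N n @^-1` K) <= moment q n)%E.
  rewrite -(expectation_indic P mK) -expectationZl_ge0//; last exact: ltW.
  apply: expectation_le => //.
  - by apply: measurable_funM => //; exact: measurable_indic.
  - exact: measurable_piece_powR.
  - by move=> t; rewrite mulr_ge0// ltW.
  apply: filterS ae_admissible => t adm.
  rewrite indicE; have [/set_mem Kt|_] := boolP (t \in _).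
    rewrite mulr1 piece_powR// ler_expR; apply: Kq => //.
    exact: (tent_pieces_gt0 n adm).
  by rewrite mulr0 powR_ge0.
rewrite momentE -(fineK (fin_num_measure P _ mK)) -EFinM !lee_fin expRD expRN.
by rewrite -/c ler_pdivlMr// mulrC.
Qed.

(** * The limit [Lambda]: existence, extremal formulas, bounds and convexity *)

Lemma scaled_log_moment_cvg q : exists l : R,
  [/\ scaled_log_moment P omega q @ \oo --> l%:E,
      0 <= q -> l%:E = ereal_inf
        [set scaled_log_moment P omega q n | n in [set n | (1 <= n)%N]]
    & q < 0 -> l%:E = ereal_sup
        [set scaled_log_moment P omega q n | n in [set n | (1 <= n)%N]]].
Proof.
pose S := [set n%:R^-1 * log_moment q n | n in [set n | (1 <= n)%N]].
have S0 : S !=set0 by exists (1%:R^-1 * log_moment q 1), 1%N.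
have SE : [set scaled_log_moment P omega q n | n in [set n | (1 <= n)%N]] =
    EFin @` S.
  by rewrite /S image_comp; apply: eq_imagel => n _; rewrite scaled_log_momentE.
have Sbnd y : S y -> Num.min 0 (q * ln 2) <= y <= Num.max 0 (q * ln 2).
  move=> [n /= n1 <-]; have n0 : 0 < n%:R :> R by rewrite ltr0n.
  by rewrite ler_pdivlMl// ler_pdivrMl// log_moment_bounds.
have lbS : has_lbound S by exists (Num.min 0 (q * ln 2)) => y /Sbnd/andP[].
have ubS : has_ubound S by exists (Num.max 0 (q * ln 2)) => y /Sbnd/andP[].
have cvgE l : (fun n => n%:R^-1 * log_moment q n) @ \oo --> l ->
    scaled_log_moment P omega q @ \oo --> l%:E.
  move=> ul; apply: cvg_EFin.
    by apply: nearW => n; rewrite scaled_log_momentE.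
  suff -> : fine \o scaled_log_moment P omega q =
    (fun n => n%:R^-1 * log_moment q n) by [].
  by apply/funext => n /=; rewrite scaled_log_momentE.
rewrite SE ereal_inf_EFin// ereal_sup_EFin//.
have [q0|q0] := leP 0 q.
  exists (inf S); split=> //; apply: cvgE.
  apply: (@subadditive_cvg _ _ (Num.min 0 (q * ln 2))) => n.
    by move=> m; exact: (log_momentD q n m).1.
  by have /andP[] := log_moment_bounds q n.
exists (sup S); split=> //; apply: cvgE.
(* For [q < 0] the sequence is superadditive, so Fekete's lemma is applied to its negative and the
   infimum becomes a supremum. *)
have := @subadditive_cvg _ (fun n => - log_moment q n) (- Num.max 0 (q * ln 2)).
set S' := [set _ | _ in _]; move=> ucvg.
have -> : sup S = - inf S'.
  rewrite /inf opprK; congr sup; rewrite image_comp.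
  by apply: eq_imagel => n _ /=; rewrite mulrN opprK.
rewrite (_ : (fun n => _) = (fun n => - (n%:R^-1 * - log_moment q n))); last first.
  by apply/funext => n; rewrite mulrN opprK.
apply: cvgN; apply: ucvg => n.
  by move=> m; rewrite -opprD lerN2; apply: (log_momentD q n m).2; exact: ltW.
by rewrite mulrN lerN2; have /andP[] := log_moment_bounds q n.
Qed.

Lemma Lambda_spec q :
  [/\ scaled_log_moment P omega q @ \oo --> Lambda P omega q,
      Lambda P omega q \is a fin_num,
      0 <= q -> Lambda P omega q = ereal_inf
        [set scaled_log_moment P omega q n | n in [set n | (1 <= n)%N]]
    & q < 0 -> Lambda P omega q = ereal_sup
        [set scaled_log_moment P omega q n | n in [set n | (1 <= n)%N]]].
Proof.
have [l [lcvg linf lsup]] := scaled_log_moment_cvg q.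
suff -> : Lambda P omega q = l%:E by split.
exact/cvg_lim.
Qed.

Lemma Lambda_bounds q : ((Num.min 0 (q * ln 2))%:E <= Lambda P omega q <=
  (Num.max 0 (q * ln 2))%:E)%E.
Proof.
have [lcvg _ _ _] := Lambda_spec q.
have bnd n : (0 < n)%N -> Num.min 0 (q * ln 2) <= n%:R^-1 * log_moment q n <=
    Num.max 0 (q * ln 2).
  move=> n1; have n0 : 0 < n%:R :> R by rewrite ltr0n.
  by rewrite ler_pdivlMl// ler_pdivrMl// log_moment_bounds.
apply/andP; split; [apply: lime_ge|apply: lime_le]; try exact: (cvgP _ lcvg).
  near=> n; rewrite scaled_log_momentE lee_fin.
  have /bnd/andP[] // : (0 < n)%N by near: n; exists 1%N.
near=> n; rewrite scaled_log_momentE lee_fin.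
have /bnd/andP[] // : (0 < n)%N by near: n; exists 1%N.
Unshelve. all: by end_near. Qed.

Lemma fine_Lambda_cvg q :
  (fun n => n%:R^-1 * log_moment q n) @ \oo --> fine (Lambda P omega q).
Proof.
have [lcvg lfin _ _] := Lambda_spec q.
have -> : (fun n => n%:R^-1 * log_moment q n) =
    fine \o scaled_log_moment P omega q.
  by apply/funext => n /=; rewrite scaled_log_momentE.
by apply: fine_cvg; rewrite fineK.
Qed.

Lemma Lambda_convex_comb (p q s : R) : 0 <= s -> s <= 1 ->
  fine (Lambda P omega (s * p + (1 - s) * q)) <=
  s * fine (Lambda P omega p) + (1 - s) * fine (Lambda P omega q).
Proof.
move=> s0 s1.
have rcvg : (fun n => s * (n%:R^-1 * log_moment p n) +
      (1 - s) * (n%:R^-1 * log_moment q n)) @ \oo -->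
    s * fine (Lambda P omega p) + (1 - s) * fine (Lambda P omega q).
  by apply: cvgD; (apply: cvgM; [exact: cvg_cst|exact: fine_Lambda_cvg]).
apply: (ler_cvg_to (@fine_Lambda_cvg (s * p + (1 - s) * q)) rcvg).
apply: nearW => n /=; rewrite mulrCA (mulrCA (1 - _)) -mulrDr.
by rewrite ler_wpM2l ?invr_ge0 ?ler0n// log_moment_convex.
Qed.

Lemma Lambda_convex :
  convex_function [set: R^o] (fun q : R => fine (Lambda P omega q)).
Proof. by move=> s p q _ _; exact: Lambda_convex_comb. Qed.

(** * Exponential tail estimates and conclusion *)

(** For one fixed [q], Chernoff's inequality dominates the sequence termwise by one converging to
    [Lambda P omega q - q * x]. Optimizing over [q] is left to the final step. *)
Lemma limn_esup_prob_le q x (K : nat -> set nat) :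
  (forall n k, (0 < n)%N -> K n k -> (0 < k)%N -> n%:R * (q * x) <= q * ln k%:R) ->
  (limn_esup (scaled_log_prob P (fun n => N n @^-1` K n)) <=
   - ((q * x)%:E - Lambda P omega q))%E.
Proof.
move=> Kq; have [lcvg lfin _ _] := Lambda_spec q.
pose v n := (scaled_log_moment P omega q n - (q * x)%:E)%E.
have vcvg : v @ \oo --> (Lambda P omega q - (q * x)%:E)%E.
  apply: cvgeB => //; [by rewrite fin_num_adde_defl|exact: cvg_cst].
rewrite fin_num_oppeB// addeC.
rewrite -(cvg_lim _ vcvg)// -(is_cvg_limn_esupE (cvgP _ vcvg)).
have le_uv n : (0 < n)%N ->
    (scaled_log_prob P (fun n => N n @^-1` K n) n <= v n)%E.
  move=> n1; have n0 : 0 < n%:R :> R by rewrite ltr0n.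
  rewrite /scaled_log_prob /v scaled_log_momentE.
  have := chernoff (fun k Kk => Kq n k n1 Kk).
  set r := P _ => rle.
  have : (lne r <= (log_moment q n - n%:R * (q * x))%:E)%E.
    rewrite -[leRHS]expeRK lee_lne//= ?in_itv/= ?leey ?andbT//.
    exact: measure_ge0.
  rewrite -(@lee_pmul2l _ n%:R^-1%:E) ?lte_fin ?invr_gt0//.
  by move/le_trans; apply; rewrite -EFinM -EFinB lee_fin mulrBr mulKf ?gt_eqF.
rewrite !limn_esup_lim; apply: lee_lim; try exact: is_cvg_esups.
(* The termwise bound [le_uv] is established for positive indices, so the suprema are compared from
   rank 1 on. *)
near=> n; apply: ge_ereal_sup => _ [m /= nm <-].
apply: (le_trans (le_uv m _)).
  by rewrite (leq_trans _ nm)//; near: n; exists 1%N.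
by apply: ereal_sup_ubound; exists m.
Unshelve. all: by end_near. Qed.

End moments.

Theorem theorem2p1 (R : realType) (eps : R) (heps0 : 0 < eps) (heps1 : eps < 1)
    (mu : probability (R * R)%type R) (hmu : mu (param_set eps) = 1%E)
    (d : measure_display) (Omega : measurableType d) (P : probability Omega R)
    (omega : nat -> {mfun Omega >-> (R * R)%type})
    (homega : iid_with_law P omega mu) :
  [/\ (forall q : R, cvgn (scaled_log_moment P omega q)),
      (forall q : R,
         (0 <= q -> Lambda P omega q = ereal_inf
           [set scaled_log_moment P omega q n | n in [set n | (1 <= n)%N]]) /\
         (q < 0 -> Lambda P omega q = ereal_sup
           [set scaled_log_moment P omega q n | n in [set n | (1 <= n)%N]])),
      (forall q : R, Lambda P omega q \is a fin_num) /\
      convex_function [set: R^o] (fun q : R => fine (Lambda P omega q)),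
      (forall q : R, ((Num.min 0 (q * ln 2))%:E <= Lambda P omega q)%E /\
                     (Lambda P omega q <= (Num.max 0 (q * ln 2))%:E)%E)
    & (forall x : R,
         (limn_esup (scaled_log_prob P
            (fun n => [set t | (x <= growth_rate omega n t)%R])) <=
          - I_plus P omega x)%E /\
         (limn_esup (scaled_log_prob P
            (fun n => [set t | (growth_rate omega n t <= x)%R])) <=
          - I_minus P omega x)%E)].
Proof.
have spec := Lambda_spec hmu homega.
split.
- by move=> q; have [lcvg _ _ _] := spec q; exact: cvgP lcvg.
- by move=> q; have [_ _ linf lsup] := spec q.
- split=> [q|]; first by have [] := spec q.
  exact (Lambda_convex hmu homega).
- by move=> q; apply/andP; exact (Lambda_bounds hmu homega q).
(* Moving the sign across turns the bound by minus a supremum into one bound for each [q].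
   Multiplying the condition on the growth rate by [q] keeps the inequality for [q >= 0] and
   reverses it for [q <= 0], as the respective tails require. *)
- move=> x; split; rewrite leeNr; apply: ge_ereal_sup => _ [q /= q0 <-];
    rewrite leeNr.
    apply: (limn_esup_prob_le hmu homega
      (K := fun n => [set k | x <= n%:R^-1 * ln k%:R])) => n k n1 /= xk k0.
    by rewrite mulrCA ler_wpM2l// -ler_pdivlMl ?ltr0n.
  apply: (limn_esup_prob_le hmu homega
    (K := fun n => [set k | n%:R^-1 * ln k%:R <= x])) => n k n1 /= xk k0.
  by rewrite mulrCA ler_wnM2l// -ler_pdivrMl ?ltr0n.
Qed.
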